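(* Let $K$ be a simplicial $3$-sphere, and let $\lambda^{\mathbb R}\colon V(K)\to\mathbb Z_2^4$ be a mod $2$ characteristic map over $K$. If $|\operatorname{im}\lambda^{\mathbb R}|\le 13$, then $\lambda^{\mathbb R}$ has a lift.
   Context: $\mathbb Z_2=\mathbb Z/2\mathbb Z$. A simplicial $3$-sphere is a (finite, abstract) simplicial complex whose geometric realization is homeomorphic to $S^3$. $V(K)$ is the vertex set of $K$; facets are maximal simplices. A mod $2$ characteristic map over $K$ is a map $\lambda^{\mathbb R}\colon V(K)\to\mathbb Z_2^4$ such that the images of the four vertices of every facet form a basis of $\mathbb Z_2^4$; $\operatorname{im}\lambda^{\mathbb R}\subset\mathbb Z_2^4$ is the set of its values on vertices. An integral characteristic map over $K$ is a map $\lambda\colon V(K)\to\mathbb Z^4$ such that the images of the four vertices of every facet form a basis of $\mathbb Z^4$. A lift of $\lambda^{\mathbb R}$ is an integral characteristic map $\lambda$ over $K$ with $\lambda(v)\equiv\lambda^{\mathbb R}(v)\pmod 2$ for every vertex $v$. *)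

(* Defs.v *)
From HB Require Import structures.
From mathcomp Require Import all_boot all_order all_algebra.
From mathcomp Require Import all_classical all_reals all_analysis.

Set Implicit Arguments.
Unset Strict Implicit.
Unset Printing Implicit Defensive.

Import Order.TTheory GRing.Theory Num.Theory.
Import numFieldNormedType.Exports.

Local Open Scope ring_scope.

(* The vertex set is the whole of T: there are no ghost vertices. The empty
   simplex is a face as soon as T is inhabited. *)
Record simplicial_complex (T : finType) := SimplicialComplex {
  faces :> {set {set T}};
  vertex_face : forall v : T, [set v]%SET \in faces;
  face_closed : forall s t : {set T},
    s \in faces -> t \subset s -> t \in faces }.

Definition facet (T : finType) (K : simplicial_complex T) (s : {set T}) : bool :=
  maxset (fun t : {set T} => t \in faces K) s.

(* Barycentric coordinates: a point of |K| is a convex combination of vertices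
   whose support is a face. *)
Definition geometric_realization (R : realType) (T : finType)
    (K : simplicial_complex T) : set {ptws T -> R} :=
  [set x : {ptws T -> R} |
    [/\ forall v, 0 <= x v,
        \sum_v x v = 1 &
        [set v | x v != 0]%SET \in faces K]]%classic.
Arguments geometric_realization R {T} K.

(* The unit sphere S^n of Euclidean R^(n+1); the norm `|x| on 'rV[R]_n.+1 is
   the sup norm, hence the explicit sum of squares. *)
Definition unit_sphere (R : realType) (n : nat) : set 'rV[R]_n.+1 :=
  [set x : 'rV[R]_n.+1 | \sum_i x 0 i ^+ 2 = 1]%classic.
Arguments unit_sphere R n : clear implicits.

Definition homeomorphic (X Y : topologicalType) : Prop :=
  exists (f : X -> Y) (g : Y -> X),
    [/\ cancel f g, cancel g f, continuous f & continuous g].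

(* The two subsets are taken as types (set_type), with the induced topology. *)
Definition simplicial_sphere (R : realType) (n : nat) (T : finType)
    (K : simplicial_complex T) : Prop :=
  homeomorphic (set_type (geometric_realization R K))
               (set_type (unit_sphere R n)).

(* Basis of a module over an arbitrary ring; basis_of is only available over
   fields. *)
Definition module_basis (A : nzRingType) (V : lmodType A) (e : seq V) : Prop :=
  forall w : V, exists! c : {ffun 'I_(size e) -> A},
    w = \sum_(i < size e) c i *: e`_i.

Definition mod2_characteristic (T : finType) (K : simplicial_complex T)
    (lam : T -> 'rV['F_2]_4) : Prop :=
  forall s : {set T}, facet K s ->
    basis_of {:'rV['F_2]_4}%VS [seq lam v | v <- enum s].

Definition integral_characteristic (T : finType) (K : simplicial_complex T)
    (lam : T -> 'rV[int]_4) : Prop :=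
  forall s : {set T}, facet K s -> module_basis [seq lam v | v <- enum s].

Definition is_lift (T : finType) (K : simplicial_complex T)
    (lamR : T -> 'rV['F_2]_4) (lam : T -> 'rV[int]_4) : Prop :=
  integral_characteristic K lam /\
  forall v, map_mx (intr : int -> 'F_2) (lam v) = lamR v.

(* Main.v *)
Require Import Defs.
From HB Require Import structures.
From mathcomp Require Import all_boot all_order all_fingroup all_algebra.
From mathcomp Require Import all_classical all_reals all_analysis.

(** Call the value of the characteristic map at a vertex its colour.  All
    colours are lifted into one finite set of integer vectors, in which every
    four vectors with odd determinant form a basis of Z^4.  There are at most 13
    colours, so two nonzero vectors of F_2^4 are omitted
    ([two_nonzero_vectors_omitted]).  GL_4(F_2) is transitive on pairs of
    distinct nonzero vectors ([GL_F2_transitive_pairs]) and all its elements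
    are reductions of elements of GL_4(Z) ([unimodular_lift]), so a change of
    coordinates moves the two omitted vectors to f1 + f2 + f3 and
    f0 + f1 + f2 + f3, where f0, ..., f3 is the standard basis.

    The other vectors of F_2^4 are then lifted as follows ([root_or_cap_lift]):
    - 0, f_i and f_i + f_j are lifted to 0, f_i and f_i - f_j, that is, to
      differences of vertices of the simplex with vertices 0, f0, ..., f3;
      these are the roots of type A_4 and 0, all called roots below;
    - f0 + f_i + f_j is lifted to the cap f_i + f_j - f0, which is a sum of the
      two roots f_i - f0 and f_j.

    A square matrix whose rows are roots has determinant 0 or a sign
    ([det_roots_le1]).  The difference of two caps is again a root, so when
    some row is a cap, row operations turn all other caps into roots; writing
    the remaining cap as a sum of two roots shows that the determinant is at
    most 2 in absolute value ([det_roots_caps_le2]).  Over a facet the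
    determinant is odd, because the colours form a basis of F_2^4, hence it is
    a sign, and the lifts form a basis of Z^4. *)

Set Implicit Arguments.
Unset Strict Implicit.
Unset Printing Implicit Defensive.

Import Order.TTheory GRing.Theory Num.Theory.
Local Open Scope ring_scope.

Local Notation mod2 := (map_mx (intr : int -> 'F_2)).

(** * Determinants of matrices of roots *)

(** The vertices of the standard simplex of Z^n, the origin being [None]. *)
Definition simplex_vertex n (o : option 'I_n) : 'rV[int]_n :=
  if o is Some i then delta_mx 0 i else 0.

(** The roots of type A_n, together with 0: the pairs of equal vertices are
    allowed so that deleting a coordinate sends roots to roots. *)
Definition root_vector n (x : 'rV[int]_n) : Prop :=
  exists a b, x = simplex_vertex a - simplex_vertex b.

Lemma col'_simplex_vertex n (j : 'I_n.+1) (o : option 'I_n.+1) :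
  col' j (simplex_vertex o) = simplex_vertex (obind (unlift j) o).
Proof.
apply/rowP => k; rewrite mxE; case: o => [i|] /=; last by rewrite !mxE.
rewrite mxE eqxx /=; case: unliftP => [i' ->|->] /=.
  by rewrite mxE (inj_eq lift_inj).
by rewrite mxE eq_sym (negPf (neq_lift _ _)).
Qed.

Lemma sum_delta_row n (i : 'I_n) : \sum_j (delta_mx 0 i : 'rV[int]_n) 0 j = 1.
Proof.
rewrite (bigD1 i) //= mxE !eqxx big1 ?addr0 // => j ji.
by rewrite mxE eqxx (negPf ji).
Qed.

(** A root with nonzero coordinate sum involves the origin of the simplex, so
    it is a signed basis vector, and expanding along it leaves a smaller matrix
    of roots.  If all rows have coordinate sum 0, the all-ones vector is in the
    kernel. *)
Lemma det_roots_le1 n (A : 'M[int]_n) :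
  (forall i, root_vector (row i A)) -> `|\det A| <= 1.
Proof.
elim: n A => [|n IHn] A rootA; first by rewrite det_mx00 normr1.
have [/existsP[i sum_i]|/existsPn sum0] := boolP [exists i, \sum_j A i j != 0].
  have [j /orP row_i] :
      exists j, (row i A == delta_mx 0 j) || (row i A == - delta_mx 0 j).
    have [a [b def_i]] := rootA i; move: sum_i.
    have -> : \sum_j A i j = \sum_j row i A 0 j.
      by apply: eq_bigr => k _; rewrite mxE.
    rewrite {}def_i; case: a b => [j|] [k|] /=.
    - under eq_bigr do rewrite mxE [X in _ + X]mxE.
      by rewrite sumrB !sum_delta_row subrr eqxx.
    - by move=> _; exists j; rewrite subr0 eqxx.
    - by move=> _; exists k; rewrite sub0r eqxx orbT.
    - by rewrite subr0 big1 ?eqxx // => l _; rewrite mxE.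
  have entry k : k != j -> A i k = 0.
    move=> kj; have -> : A i k = row i A 0 k by rewrite mxE.
    by case: row_i => /eqP->; rewrite !mxE eqxx (negPf kj) ?oppr0.
  have pivot : `|A i j| = 1.
    have -> : A i j = row i A 0 j by rewrite mxE.
    by case: row_i => /eqP->; rewrite !mxE !eqxx ?normrN normr1.
  rewrite (expand_det_row _ i) (bigD1 j) //= big1 ?addr0; last first.
    by move=> k kj; rewrite entry ?mul0r.
  rewrite normrM pivot mul1r /cofactor normrM normrX normrN1 expr1n mul1r.
  apply: IHn => k; have [a [b def_k]] := rootA (lift i k).
  exists (obind (unlift j) a), (obind (unlift j) b).
  rewrite -!col'_simplex_vertex; apply/rowP => l.
  by move/rowP/(_ (lift j l)): def_k; rewrite !mxE.
have -> : \det A = 0; last by rewrite normr0.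
rewrite -det_tr; apply/eqP/det0P; exists (const_mx 1).
  by apply/eqP => /rowP/(_ ord0)/eqP; rewrite !mxE oner_eq0.
apply/rowP => i; rewrite !mxE -[RHS](eqP (negPn (sum0 i))).
by apply: eq_bigr => j _; rewrite !mxE mul1r.
Qed.

Lemma norm_int_unit (x : int) : x \is a GRing.unit -> `|x| = 1.
Proof. by rewrite qualifE /= => /orP[] /eqP->. Qed.

(** The row operations are left multiplication by 1 + E with E of square 0,
    hence by a unimodular matrix. *)
Lemma norm_det_row_ops n (A : 'M[int]_n) i0 (c : 'cV_n) :
  c i0 0 = 0 -> `|\det (A + c *m row i0 A)| = `|\det A|.
Proof.
move=> c0; pose E : 'M[int]_n := c *m delta_mx 0 i0.
have EE : E *m E = 0.
  rewrite /E mulmxA -[X in X *m _]mulmxA -rowE.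
  suff -> : row i0 c = 0 by rewrite mulmx0 mul0mx.
  by apply/rowP => j; rewrite !mxE (ord1 j).
have -> : A + c *m row i0 A = (1%:M + E) *m A.
  by rewrite mulmxDl mul1mx /E -mulmxA -rowE.
have /mulmx1_unit[+ _] : (1%:M + E) *m (1%:M - E) = 1%:M.
  by rewrite mulmxDl mul1mx mulmxBr mulmx1 EE subr0 subrK.
by rewrite unitmxE det_mulmx normrM => /norm_int_unit->; rewrite mul1r.
Qed.

(** Subtracting one row in C from the others in C makes every other row a root;
    the determinant is then the sum of two determinants of matrices of roots,
    by linearity in the row that is left. *)
Lemma det_roots_caps_le2 n (C : 'rV[int]_n -> Prop) (A : 'M[int]_n) :
    (forall x, C x ->
       exists r s, [/\ root_vector r, root_vector s & x = r + s]) ->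
    (forall x y, C x -> C y -> root_vector (x - y)) ->
    (forall i, root_vector (row i A) \/ C (row i A)) ->
  `|\det A| <= 2.
Proof.
move=> Csum Cdiff rowsA.
have [[i0 Ci0]|noC] := pselect (exists i, C (row i A)); last first.
  apply: (@le_trans _ _ 1) => //; apply: det_roots_le1 => i.
  by case: (rowsA i) => // Ci; case: noC; exists i.
have /choice[c cP] : forall i, exists ci : int, (i = i0 -> ci = 0) /\
    (i != i0 -> root_vector (row i A + ci *: row i0 A)).
  move=> i; have [->|ii0] := eqVneq i i0; first by exists 0.
  case: (rowsA i) => [ri|Ci].
    by exists 0; split=> // _; rewrite scale0r addr0.
  exists (-1); split=> [ii0'|_]; first by rewrite ii0' eqxx in ii0.
  by rewrite scaleN1r; apply: Cdiff.
pose B := A + (\col_i c i) *m row i0 A.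
have rowB i : row i B = row i A + c i *: row i0 A.
  by apply/rowP => j; rewrite !mxE big_ord1 !mxE.
have -> : `|\det A| = `|\det B|.
  by rewrite norm_det_row_ops // mxE; apply: (cP i0).1.
have [r [s [rr rs def_i0]]] := Csum _ Ci0.
pose repl t : 'M[int]_n := \matrix_i (if i == i0 then t else row i B).
have row_repl t i : row i (repl t) = if i == i0 then t else row i B.
  exact: rowK.
have repl_le1 t : root_vector t -> `|\det (repl t)| <= 1.
  move=> rt; apply: det_roots_le1 => i; rewrite row_repl.
  by case: eqVneq => // ii0; rewrite rowB; apply: (cP i).2.
have row'_repl t : row' i0 (repl t) = row' i0 B.
  apply/row_matrixP => i; apply/rowP => j; rewrite !mxE eq_sym.
  by rewrite (negPf (neq_lift _ _)) !mxE.
have -> : \det B = 1 * \det (repl r) + 1 * \det (repl s).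
  apply: (@determinant_multilinear _ _ _ _ _ i0); rewrite ?row'_repl //.
  by rewrite !row_repl eqxx !scale1r rowB (cP i0).1 // scale0r addr0.
rewrite !mul1r; apply: le_trans (ler_normD _ _) _.
by apply: (@lerD _ _ 1 _ 1); apply: repl_le1.
Qed.

Lemma unitmx_of_odd_det n (A : 'M[int]_n) :
  `|\det A| <= 2 -> mod2 A \in unitmx -> A \in unitmx.
Proof.
rewrite !unitmxE det_map_mx unitfE.
by case: (\det A) => [] [|[|[|k]]].
Qed.

(** * Linear groups over F_2 *)

Lemma F2_cases (x : 'F_2) : x = 0 \/ x = 1.
Proof. by case: x => [[|[|//]] ?]; [left|right]; apply: val_inj. Qed.

(** In a factorisation g = P^-1 L U over F_2 all diagonal entries of the
    triangular factors are 1, so lifting every entry of the three factors to 0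
    or 1 gives integer matrices of determinant 1 or -1. *)
Lemma unimodular_lift n (g : 'M['F_2]_n) :
  g \in unitmx -> exists2 G : 'M[int]_n, G \in unitmx & mod2 G = g.
Proof.
case: n g => [|n] g ug.
  by exists 1%:M; [rewrite unitmx1|apply/matrixP => [[]]].
case: (cormen_lup g) (cormen_lup_correct g) (cormen_lup_perm g)
  (@cormen_lup_lower _ _ g) (@cormen_lup_upper _ _ g)
  => [[P L] U] /= PgLU /is_perm_mxP[s def_P] lowL upU.
pose rep (X : 'M['F_2]_n.+1) : 'M[int]_n.+1 :=
  map_mx (fun x : 'F_2 => (x : nat)%:Z) X.
have repK X : mod2 (rep X) = X.
  by apply/matrixP => i j; rewrite !mxE -pmulrn; exact: (natr_Zp (X i j)).
have detU : \det U = \prod_i U i i.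
  rewrite -det_tr det_trig; last by apply/is_trig_mxP => i j ij; rewrite mxE upU.
  by apply: eq_bigr => i _; rewrite mxE.
have det_nz : \det U != 0.
  rewrite -unitfE -unitmxE; have : L *m U \in unitmx.
    by rewrite -[L *m U]PgLU unitmx_mul ug andbT def_P; exact: unitmx_perm.
  by rewrite unitmx_mul => /andP[].
have diagU i : U i i = 1.
  have : U i i != 0 by move: det_nz; rewrite detU => /prodf_neq0/(_ i isT).
  by case: (F2_cases (U i i)) => ->; rewrite ?eqxx.
have unitL : rep L \in unitmx.
  rewrite unitmxE det_trig; last first.
    apply/is_trig_mxP => i j ij.
    by rewrite mxE lowL ?(ltnW ij) // -val_eqE /= (ltn_eqF ij).
  by rewrite big1 ?unitr1 // => i _; rewrite mxE lowL ?eqxx.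
have unitU : rep U \in unitmx.
  rewrite unitmxE -det_tr det_trig; last first.
    by apply/is_trig_mxP => i j ij; rewrite !mxE upU.
  by rewrite big1 ?unitr1 // => i _; rewrite !mxE diagU.
exists ((perm_mx s)^T *m (rep L *m rep U)).
  by rewrite !unitmx_mul unitmx_tr unitmx_perm unitL.
rewrite !map_mxM -map_trmx map_perm_mx !repK -[L *m U]PgLU def_P.
by rewrite mulmxA tr_perm_mx -perm_mxM mulVg perm_mx1 mul1mx.
Qed.

Lemma row_free_F2_pair n (u v : 'rV['F_2]_n) :
  u != 0 -> v != 0 -> u != v -> row_free (col_mx u v).
Proof.
move=> u0 v0 uv; apply: inj_row_free => w.
rewrite -[w]hsubmxK mul_row_col (mx11_scalar (lsubmx w)).
rewrite (mx11_scalar (rsubmx w)) !mul_scalar_mx.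
case: (F2_cases (lsubmx w 0 0)) (F2_cases (rsubmx w 0 0)) => -> [] ->.
- by rewrite raddf0 row_mx0.
- by rewrite scale0r add0r scale1r => /eqP; rewrite (negPf v0).
- by rewrite scale0r addr0 scale1r => /eqP; rewrite (negPf u0).
rewrite !scale1r => /eqP; rewrite addr_eq0.
suff -> : - v = v by rewrite (negPf uv).
apply/rowP => i; rewrite !mxE.
by case: (F2_cases (v 0 i)) => ->; apply: val_inj.
Qed.

(** Both pairs are free, so a linear map taking one to the other is injective
    on a plane and can be completed to an automorphism. *)
Lemma GL_F2_transitive_pairs n (u v u' v' : 'rV['F_2]_n) :
    u != 0 -> v != 0 -> u != v -> u' != 0 -> v' != 0 -> u' != v' ->
  exists g : 'M['F_2]_n, [/\ g \in unitmx, u *m g = u' & v *m g = v'].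
Proof.
move=> u0 v0 uv u0' v0' uv'.
have fU := row_free_F2_pair u0 v0 uv.
have fU' := row_free_F2_pair u0' v0' uv'.
pose f := pinvmx (col_mx u v) *m col_mx u' v'.
have Uf : col_mx u v *m f = col_mx u' v' by rewrite mulmxA mulmxVp ?mul1mx.
have [|g ug] := @complete_unitmx _ _ _ (col_mx u v) f.
  by rewrite Uf (eqP fU) (eqP fU').
by rewrite Uf mul_col_mx => /eq_col_mx[-> ->]; exists g.
Qed.

Lemma two_nonzero_vectors_omitted (S : {set 'rV['F_2]_4}) :
  (#|S| <= 13)%N ->
  exists u v, [/\ u != 0, v != 0, u != v, u \notin S & v \notin S].
Proof.
move=> cardS; have : (1 < #|(~: (0%R |: S))%SET|)%N.
  rewrite cardsCs finset.setCK card_mx card_Fp // ltn_subRL addn1.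
  rewrite cardsU1; have /leq_trans : ((0%R \notin S) + #|S| <= 1 + 13)%N.
    by rewrite leq_add ?leq_b1.
  by apply.
case/card_gt1P => u [v []]; rewrite !inE !negb_or.
by move=> /andP[u0 uS] /andP[v0 vS] uv; exists u, v.
Qed.

(** * The fourteen lifted vectors *)

(** With h = f1 + f2 + f3 - f0, this is h - f_k for k = 1, 2, 3, that is
    f_i + f_j - f0 where i, j, k are 1, 2, 3 in some order.  The form h - f_k
    makes it plain that differences of caps are roots. *)
Definition cap_vector (x : 'rV[int]_4) : Prop :=
  exists2 k : 'I_4, k != 0 & x = const_mx 1 - 2 *: delta_mx 0 0 - delta_mx 0 k.

Definition root_or_cap (x : 'rV[int]_4) : Prop :=
  root_vector x \/ cap_vector x.

Definition omitted1 : 'rV['F_2]_4 := \row_i (i != 0)%:R.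
Definition omitted2 : 'rV['F_2]_4 := const_mx 1.

Lemma cap_vectorB x y : cap_vector x -> cap_vector y -> root_vector (x - y).
Proof.
move=> [k _ ->] [l _ ->]; exists (Some l), (Some k) => /=.
by rewrite opprB addrC addrA subrK.
Qed.

Local Ltac row4_by_entries :=
  apply/rowP; case=> [[|[|[|[|//]]]] ?]; rewrite !mxE //=.

Local Notation o1 := (@Ordinal 4 1 isT).
Local Notation o2 := (@Ordinal 4 2 isT).
Local Notation o3 := (@Ordinal 4 3 isT).

Lemma cap_vector_sum_roots x : cap_vector x ->
  exists r s, [/\ root_vector r, root_vector s & x = r + s].
Proof.
pose f i : 'rV[int]_4 := simplex_vertex (Some i).
have sum i j : exists r s,
    [/\ root_vector r, root_vector s & f i - f 0 + f j = r + s].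
  exists (f i - f 0), (f j - 0); split; last by rewrite subr0.
    by exists (Some i), (Some 0).
  by exists (Some j), None.
move=> [[[|[|[|[|//]]]] ?] // _ ->].
- by rewrite (_ : _ - _ = f o2 - f 0 + f o3); [exact: sum|row4_by_entries].
- by rewrite (_ : _ - _ = f o1 - f 0 + f o3); [exact: sum|row4_by_entries].
- by rewrite (_ : _ - _ = f o1 - f 0 + f o2); [exact: sum|row4_by_entries].
Qed.

Lemma det_root_or_cap_le2 (A : 'M[int]_4) :
  (forall i, root_or_cap (row i A)) -> `|\det A| <= 2.
Proof. exact: det_roots_caps_le2 cap_vector_sum_roots cap_vectorB. Qed.

(** Vectors of weight at most 2 are reductions of roots, and those of weight 3
    with first coordinate 1 are reductions of caps; this leaves only the vector
    of weight 3 with first coordinate 0 and the vector of weight 4. *)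
Lemma root_or_cap_lift (w : 'rV['F_2]_4) :
  w != omitted1 -> w != omitted2 -> exists2 x, root_or_cap x & mod2 x = w.
Proof.
have bit (x : 'F_2) : exists b : bool, x = b%:R.
  by case: (F2_cases x) => ->; [exists false|exists true].
have [a w0] := bit (w 0 0); have [b w1] := bit (w 0 o1).
have [c w2] := bit (w 0 o2); have [d w3] := bit (w 0 o3).
have -> : w = \row_i (nth false [:: a; b; c; d] i)%:R.
  apply/rowP; case=> [[|[|[|[|//]]]] ?]; rewrite mxE /= -?w0 -?w1 -?w2 -?w3;
    by congr (w 0 _); apply: val_inj.
have by_root u v y : mod2 (simplex_vertex u - simplex_vertex v) = y ->
    exists2 x, root_or_cap x & mod2 x = y.
  by move=> <-; exists (simplex_vertex u - simplex_vertex v); [left; exists u, v|].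
have by_cap (k : 'I_4) y : k != 0 ->
    mod2 (const_mx 1 - 2 *: delta_mx 0 0 - delta_mx 0 k) = y ->
    exists2 x, root_or_cap x & mod2 x = y.
  by move=> k0 <-; eexists; [right; exists k|].
case: a b c d {w0 w1 w2 w3} => [] [] [] [] ne1 ne2.
- by case/eqP: ne2; row4_by_entries.
- by apply: (by_cap o3) => //; row4_by_entries; apply: val_inj.
- by apply: (by_cap o2) => //; row4_by_entries; apply: val_inj.
- by apply: (by_root (Some 0) (Some o1)); row4_by_entries; apply: val_inj.
- by apply: (by_cap o1) => //; row4_by_entries; apply: val_inj.
- by apply: (by_root (Some 0) (Some o2)); row4_by_entries; apply: val_inj.
- by apply: (by_root (Some 0) (Some o3)); row4_by_entries; apply: val_inj.
- by apply: (by_root (Some 0) None); row4_by_entries; apply: val_inj.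
- by case/eqP: ne1; row4_by_entries.
- by apply: (by_root (Some o1) (Some o2)); row4_by_entries; apply: val_inj.
- by apply: (by_root (Some o1) (Some o3)); row4_by_entries; apply: val_inj.
- by apply: (by_root (Some o1) None); row4_by_entries; apply: val_inj.
- by apply: (by_root (Some o2) (Some o3)); row4_by_entries; apply: val_inj.
- by apply: (by_root (Some o2) None); row4_by_entries; apply: val_inj.
- by apply: (by_root (Some o3) None); row4_by_entries; apply: val_inj.
- by apply: (by_root None None); row4_by_entries; apply: val_inj.
Qed.

(** * Bases and invertible matrices *)

Lemma free_rows_unitmx (F : fieldType) n (e : seq 'rV[F]_n) :
  size e = n -> free e -> \matrix_(i < n) e`_i \in unitmx.
Proof.
move=> /eqP sz_e free_e; rewrite unitmxE unitfE; apply/det0P => -[k /eqP nz_k].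
rewrite mulmx_sum_row => sum0; apply: nz_k; apply/rowP => i; rewrite mxE.
apply: (elimT (freeP (X := Tuple sz_e)) free_e (fun i => k 0 i)).
by rewrite -[RHS]sum0; apply: eq_bigr => j _; rewrite rowK.
Qed.

Lemma module_basis_rows (R : comUnitRingType) n (e : seq 'rV[R]_n) :
  size e = n -> \matrix_(i < n) e`_i \in unitmx -> module_basis e.
Proof.
move=> sz_e; set M := \matrix_i _ => uM w.
have comb (c : 'I_(size e) -> R) :
    \sum_i c i *: e`_i = (\row_i c (cast_ord (esym sz_e) i)) *m M.
  rewrite mulmx_sum_row (reindex (cast_ord (esym sz_e))) /=; last first.
    by exists (cast_ord sz_e) => i _; rewrite ?cast_ordK ?cast_ordKV.
  by apply: eq_bigr => i _; rewrite rowK mxE.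
exists [ffun i => (w *m invmx M) 0 (cast_ord sz_e i)]; split=> [|c].
  rewrite comb (_ : \row_i _ = w *m invmx M) ?mulmxKV //.
  by apply/rowP => i; rewrite mxE ffunE cast_ordKV.
rewrite comb => ->; apply/ffunP => i.
by rewrite ffunE mulmxK // mxE cast_ordK.
Qed.

(** * The lift *)

Theorem theorem3p6 (R : realType) (T : finType) (K : simplicial_complex T)
  (lamR : T -> 'rV['F_2]_4)
  (K_sphere : simplicial_sphere R 3 K)
  (lamR_char : mod2_characteristic K lamR)
  (card_im : (#|[set lamR v | v : T]%SET| <= 13)%N) :
  exists lam : T -> 'rV[int]_4, is_lift K lamR lam.
Proof.
have [u [v [u0 v0 uv uS vS]]] := two_nonzero_vectors_omitted card_im.
have [om1 om2 om12] :
    [/\ omitted1 != 0, omitted2 != 0 & omitted1 != omitted2].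
  by split; apply/eqP => /rowP; [move/(_ 1)|move/(_ 0)|move/(_ 0)];
    rewrite !mxE.
have [g [ug def_u def_v]] := GL_F2_transitive_pairs om1 om2 om12 u0 v0 uv.
have [G uG redG] := unimodular_lift ug.
have im_lamR w : lamR w \in [set lamR v | v : T]%SET by apply: imset_f.
(* In the coordinates given by g, no colour is one of the two omitted vectors. *)
have /choice[y yP] w :
    exists y, root_or_cap y /\ mod2 y = lamR w *m invmx g.
  have [||y ? ?] := @root_or_cap_lift (lamR w *m invmx g); last by exists y.
  - by apply: contraNneq uS => /(canRL (mulmxKV ug)); rewrite def_u => <-.
  - by apply: contraNneq vS => /(canRL (mulmxKV ug)); rewrite def_v => <-.
exists (fun w => y w *m G); split=> [s facet_s|w]; last first.
  by rewrite map_mxM redG (yP w).2 mulmxKV.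
have basis_s := lamR_char s facet_s.
have size_s : size (enum s) = 4%N.
  have := @size_basis _ _ _ _ (in_tuple [seq lamR w | w <- enum s]) basis_s.
  by rewrite dimvf /= size_map => <-.
have [w0 _] : exists w0, w0 \in enum s.
  by case: (enum s) size_s => // w0 ? _; exists w0; rewrite mem_head.
pose A : 'M[int]_4 := \matrix_i y (nth w0 (enum s) i).
have rowsA i : row i A = y (nth w0 (enum s) i) by apply: rowK.
have uA : A \in unitmx.
  apply: unitmx_of_odd_det.
    by apply: det_root_or_cap_le2 => i; rewrite rowsA; apply: (yP _).1.
  have uE : \matrix_(i < 4) [seq lamR w | w <- enum s]`_i \in unitmx.
    by apply: free_rows_unitmx (basis_free basis_s); rewrite size_map.
  rewrite (_ : mod2 A = \matrix_(i < 4) [seq lamR w | w <- enum s]`_i *m invmx g).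
    by rewrite unitmx_mul uE unitmx_inv.
  apply/row_matrixP => i; rewrite -map_row rowsA (yP _).2 row_mul rowK.
  by rewrite (nth_map w0) // size_s.
apply: module_basis_rows; first by rewrite size_map.
rewrite (_ : \matrix_i _ = A *m G); first by rewrite unitmx_mul uA.
apply/row_matrixP => i; rewrite row_mul rowsA rowK.
by rewrite (nth_map w0) // size_s.
Qed.
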